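(* Let $\mathcal I$ be a semi-ideal of subsets of a zero-dimensional compact metrizable space $K=\bigcup\mathcal I$. For any Polish group $X$ the semi-ideals $\mathcal{GHI}$ and $\mathcal{HI}$ have the weak Steinhaus property.
   Context: All groups are Abelian, written additively; a Polish group is a topological group whose underlying space is Polish. A semi-ideal on a set is a nonempty family of subsets closed under taking subsets; $K$ is nonempty. $C(K,X)$ is the space of continuous maps $K\to X$ with the compact-open topology (a Polish space). A set is comeager if its complement is meager. A subset $A$ of a Polish group $X$ is Haar-$\mathcal I$ if there is a continuous map $f:K\to X$ with $f^{-1}(A+x)\in\mathcal I$ for all $x\in X$; it is generically Haar-$\mathcal I$ if the set $\{f\in C(K,X):\forall x\in X\;\; f^{-1}(A+x)\in\mathcal I\}$ is comeager in $C(K,X)$. $\mathcal{HI}$ (resp. $\mathcal{GHI}$) is the family of all subsets of Borel Haar-$\mathcal I$ (resp. Borel generically Haar-$\mathcal I$) sets in $X$. A family $\mathcal F$ of subsets of $X$ has the weak Steinhaus property if for every Borel subset $A\notin\mathcal F$ of $X$ the difference $A-A=\{a-b:a,b\in A\}$ is not meager in $X$. *)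

(* Defs.v *)
From mathcomp Require Import all_boot all_order all_algebra.
From mathcomp Require Import all_classical all_reals all_analysis.

Set Implicit Arguments.
Unset Strict Implicit.
Unset Printing Implicit Defensive.

(* Gives [continuousType K X] the topology induced by [{compact-open, K -> X}]. *)
Import ArrowAsCompactOpen.
Import Order.TTheory GRing.Theory Num.Theory.

Local Open Scope classical_set_scope.
Local Open Scope ring_scope.

Section Topology.

Definition compatible_metric (R : realType) (T : topologicalType)
    (d : T -> T -> R) : Prop :=
  [/\ forall x y, d x y = 0 <-> x = y,
      forall x y, d x y = d y x,
      forall x y z, d x z <= d x y + d y z &
      forall x, nbhs x = nbhs_ball_ (fun x e => [set y | d x y < e]) x].

Definition complete_metric (R : realType) (T : topologicalType)
    (d : T -> T -> R) : Prop :=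
  forall u : nat -> T,
    (forall e : R, 0 < e ->
      exists N, forall m n, (N <= m)%N -> (N <= n)%N -> d (u m) (u n) < e) ->
    exists l : T, u @ \oo --> l.

Definition metrizable (R : realType) (T : topologicalType) : Prop :=
  exists d : T -> T -> R, compatible_metric d.

Definition separable (T : topologicalType) : Prop :=
  exists2 D : set T, countable D & dense D.

Definition polish (R : realType) (T : topologicalType) : Prop :=
  separable T /\
  exists2 d : T -> T -> R, compatible_metric d & complete_metric d.

(* The library's [zero_dimensional] only asks that distinct points be separated
   by clopen sets, which is weaker in general. *)
Definition has_clopen_base (T : topologicalType) : Prop :=
  forall (x : T) (U : set T), open U -> U x ->
    exists V : set T, [/\ clopen V, V x & V `<=` U].

Definition nowhere_dense (T : topologicalType) (A : set T) : Prop :=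
  (closure A)° = set0.

Definition meager (T : topologicalType) (A : set T) : Prop :=
  exists2 F : nat -> set T,
    (forall n, nowhere_dense (F n)) & A `<=` \bigcup_n F n.

Definition comeager (T : topologicalType) (A : set T) : Prop :=
  meager (~` A).

Definition borel (T : topologicalType) : set (set T) := <<s @open T >>.

End Topology.

Definition semi_ideal (T : Type) (I : set (set T)) : Prop :=
  I !=set0 /\ forall A B, A `<=` B -> I B -> I A.

Section Haar.
Variables (K : topologicalType) (X : topologicalZmodType).
Implicit Types (I : set (set K)) (A : set X).

Definition translate A (x : X) : set X := [set a + x | a in A].

Definition haar_witness I A (f : continuousType K X) : Prop :=
  forall x : X, I (f @^-1` translate A x).

Definition haar I A : Prop := exists f, haar_witness I A f.

Definition generically_haar I A : Prop := comeager [set f | haar_witness I A f].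

Definition HI I : set (set X) :=
  [set A | exists B, [/\ borel B, haar I B & A `<=` B]].

Definition GHI I : set (set X) :=
  [set A | exists B, [/\ borel B, generically_haar I B & A `<=` B]].

End Haar.

Arguments HI {K} X I.
Arguments GHI {K} X I.

Definition weak_steinhaus (X : topologicalZmodType) (F : set (set X)) : Prop :=
  forall A : set X, borel A -> ~ F A ->
    ~ meager [set a - b | a in A & b in A].

Section SemiIdeals.
Variables (K : topologicalType) (X : topologicalZmodType) (I : set (set K)).
Hypothesis idI : semi_ideal I.

Lemma haar_witness_set0 (f : continuousType K X) : haar_witness I set0 f.
Proof.
case: idI => -[J IJ] subI x; apply: subI IJ => t.
by rewrite /translate /= => -[].
Qed.

Lemma semi_ideal_HI : semi_ideal (HI X I).
Proof.
split; last by move=> A B AB [C [bC hC BC]]; exists C; split=> //; apply: subset_trans BC.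
exists set0, set0; split=> //; first exact: sigma_algebra0.
by exists (mkcts (@cst_continuous K X 0)); exact: haar_witness_set0.
Qed.

Lemma semi_ideal_GHI : semi_ideal (GHI X I).
Proof.
split; last by move=> A B AB [C [bC hC BC]]; exists C; split=> //; apply: subset_trans BC.
exists set0, set0; split=> //; first exact: sigma_algebra0.
exists (fun=> set0) => [_|f /=]; first by rewrite /nowhere_dense closure0 interior0.
by case; exact: haar_witness_set0.
Qed.

End SemiIdeals.

(* Main.v *)
Require Import Defs.
From mathcomp Require Import all_boot all_order all_algebra.
From mathcomp Require Import all_classical all_reals all_analysis.
From mathcomp Require Import lra.

(** Suppose that A - A is meager; the claim is that A is generically Haar-I.
    The preimage f^-1(A + x) contains two points s <> t only if
    f s - f t lies in A - A. As I covers K and is closed under subsets, it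
    contains the empty set and all singletons, so it suffices that a generic
    continuous f : K -> X satisfies f s - f t \notin A - A whenever s <> t
    ([haar_witness_diff_notin]).

    Write A - A as a subset of a countable union of nowhere dense sets F_n,
    and let D_n be the complement of the closure of F_n, an open dense set.
    A map has the wanted property if it belongs, for all m and n, to
    [separated_diff r D] with r = 1 / (m + 1) and D = D_n: pairs of points at
    distance at least r are sent to pairs of points with difference in D. This
    set of maps is open because K * K is compact and evaluation is jointly
    continuous. It is dense because K is zero-dimensional: cut K into finitely
    many clopen pieces of diameter less than r on which f is nearly constant,
    replace f on each piece by a constant, and move these finitely many
    constants slightly so that their mutual differences fall in D
    ([compact_clopen_representatives], [perturb]). Points at distance at least
    r lie in different pieces. Hence the good maps are comeager
    ([comeager_diff_notin]), which settles GHI.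

    For HI a single good map is needed, so comeager sets of maps must be
    nonempty. The compact-open topology on the maps K -> X is that of uniform
    convergence for a complete metric of X ([nbhs_uniform_ball]), and the
    usual nested ball argument applies ([comeager_continuous_nonempty]). *)

Set Implicit Arguments.
Unset Strict Implicit.
Unset Printing Implicit Defensive.

Import ArrowAsCompactOpen.
Import Order.TTheory GRing.Theory Num.Theory.

Local Open Scope classical_set_scope.
Local Open Scope ring_scope.

(** * Open dense sets and meagerness *)

Section OpenDense.
Context {T : topologicalType}.
Implicit Types A D : set T.

Lemma nowhere_denseE A : nowhere_dense A <-> dense (~` closure A).
Proof.
split=> [A0 O [x Ox] oO|dA].
  apply: contrapT => OA0; have : (closure A)° x; last by rewrite A0.
  apply: filterS (open_nbhs_nbhs (conj oO Ox)) => y Oy.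
  by apply: contrapT => ncAy; apply: OA0; exists y.
apply/seteqP; split=> // x /= Ax.
have [||y [/= /interior_subset]] // := dA (closure A)°; first by exists x.
exact: open_interior.
Qed.

Lemma open_dense_forall_in (J : eqType) (s : seq J) (E : J -> set T) :
    (forall j, j \in s -> open (E j) /\ dense (E j)) ->
  open [set y | forall j, j \in s -> E j y] /\
  dense [set y | forall j, j \in s -> E j y].
Proof.
elim: s => [|i s IH] odE.
  have -> : [set y | forall j, j \in [::] -> E j y] = setT.
    by apply/seteqP; split.
  by split=> [|O O0 _]; [exact: openT|rewrite setIT].
have -> : [set y | forall j, j \in i :: s -> E j y] =
    E i `&` [set y | forall j, j \in s -> E j y].
  apply/seteqP; split=> y /=.
    by move=> Ey; split=> [|j js]; apply: Ey; rewrite inE ?eqxx ?js ?orbT.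
  by move=> [Eiy Ey] j; rewrite inE => /predU1P[->//|/Ey].
have [oi di] := odE i (mem_head _ _).
have [|os ds] := IH; first by move=> j js; apply: odE; rewrite inE js orbT.
by split; [exact: openI|exact: denseI].
Qed.

(** The index type is an arbitrary countable type, so that families indexed by
    pairs of integers need no renumbering. *)
Lemma comeager_bigcap (J : countType) (G : J -> set T) A :
    (forall j, open (G j) /\ dense (G j)) -> \bigcap_j G j `<=` A ->
  comeager A.
Proof.
move=> odG GA.
exists (fun n => if unpickle n is Some j then ~` G j else set0) => [n|x nAx].
  case: unpickle => [j|]; apply/nowhere_denseE; last first.
    by rewrite closure0 setC0 => O O0 _; rewrite setIT.
  have [oG dG] := odG j.
  by rewrite -(closure_id _).1 ?setCK//; exact: open_closedC.
apply: contrapT => nx; apply: nAx; apply: GA => j _.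
by apply: contrapT => nGjx; apply: nx; exists (pickle j) => //; rewrite pickleK.
Qed.

Lemma dense_preimage (U : topologicalType) (phi : T -> U) (psi : U -> T)
    (D : set U) : continuous psi -> cancel phi psi -> cancel psi phi ->
  dense D -> dense (phi @^-1` D).
Proof.
move=> cpsi phiK psiK dD O [x Ox] oO.
have [||z [/= Oz Dz]] := dD (psi @^-1` O).
- by exists (phi x); rewrite /= phiK.
- by apply: open_comp => // y _; exact: cpsi.
- by exists (psi z); split=> //=; rewrite psiK.
Qed.

End OpenDense.

(** * Moving finitely many points into general position *)

Section Perturbation.
Context {X : topologicalZmodType}.

Lemma continuous_subl (a : X) : continuous (fun y => a - y).
Proof.
move=> y; apply: (@continuous_comp _ _ _ (fun y => (a, y))
  (fun z : X * X => z.1 - z.2)); last exact: sub_continuous.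
by apply: cvg_pair => /=; [exact: cvg_cst|exact: cvg_id].
Qed.

Lemma continuous_subr (a : X) : continuous (fun y => y - a).
Proof.
move=> y; apply: (@continuous_comp _ _ _ (fun y => (y, a))
  (fun z : X * X => z.1 - z.2)); last exact: sub_continuous.
by apply: cvg_pair => /=; [exact: cvg_id|exact: cvg_cst].
Qed.

Lemma open_dense_sub (a : X) (D : set X) : open D -> dense D ->
  open [set y | D (y - a) /\ D (a - y)] /\
  dense [set y | D (y - a) /\ D (a - y)].
Proof.
move=> oD dD.
have oDr : open ((fun y => y - a) @^-1` D).
  by apply: open_comp => // y _; exact: continuous_subr.
have oDl : open ((fun y => a - y) @^-1` D).
  by apply: open_comp => // y _; exact: continuous_subl.
split; first exact: (openI oDr oDl).
apply: (denseI oDr).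
- apply: (@dense_preimage _ _ _ (fun y => y - - a)) => //.
  + exact: continuous_subr.
  + by move=> y; rewrite opprK subrK.
  + by move=> y; rewrite opprK addrK.
- have aK : involutive (fun y => a - y) by move=> y; rewrite opprB addrC subrK.
  apply: (@dense_preimage _ _ _ (fun y => a - y)) => //.
  exact: continuous_subl.
Qed.

(** The points are chosen one after the other: once the x j are fixed for j in
    the tail, the admissible positions y of the next point form the
    intersection of the finitely many open dense sets of those y with y - x j
    and x j - y in D. *)
Lemma perturb (J : eqType) (s : seq J) (U : J -> set X) (D : set X) :
    open D -> dense D -> (forall j, open (U j)) -> (forall j, U j !=set0) ->
  exists x : J -> X, (forall j, U j (x j)) /\
    forall i j, i \in s -> j \in s -> i != j -> D (x i - x j).
Proof.
move=> oD dD oU /choice U0; elim: s => [|i s [x [Ux Dx]]].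
  by case: U0 => x Ux; exists x.
have [is_|nis] := boolP (i \in s).
  exists x; split=> // j k; rewrite !inE => js ks; apply: Dx.
    by case/predU1P : js => [->|].
  by case/predU1P : ks => [->|].
have [_ dE] := open_dense_forall_in (s := s)
  (fun j _ => open_dense_sub (x j) oD dD).
have [||y [Uy Ey]] := dE (U i) => //; first by exists (x i).
(* Only the value at i changes; the values on s, where i does not occur, keep
   their mutual differences. *)
exists (fun j => if j == i then y else x j); split.
  by move=> j; case: eqP => [->|].
move=> j k; rewrite !inE; case: (eqVneq j i) => [->|ji] /=.
  by case: (eqVneq k i) => // ki _ ks _; case: (Ey k ks).
move=> js; case: (eqVneq k i) => [_ _ _|ki /= ks jk].
  by case: (Ey j js).
exact: Dx.
Qed.

End Perturbation.

(** * Clopen partitions of the parameter space *)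

Section ClopenPartition.
Context {K : topologicalType}.
Hypothesis K_compact : compact [set: K].

(** A clopen neighbourhood assignment on a compact space refines to a finite
    clopen partition; the partition is given by the map rep that sends a point
    to a marked point of its piece, so that functions constant on the pieces
    are those of the form x \o rep. *)
Lemma compact_clopen_representatives (V : K -> set K) :
    (forall t, clopen (V t)) -> (forall t, V t t) ->
  exists (s : seq K) (rep : K -> K), [/\ forall t, rep t \in s,
    forall t, V (rep t) t & forall t, \forall t' \near t, rep t' = rep t].
Proof.
move=> cV Vt.
have [s sV] : exists s : seq K, forall t, exists2 i, i \in s & V i t.
  (* Along the filter of ever larger finite sequences, near_covering is the
     extraction of a finite subcover. *)
  pose F := filter_from [set: seq K]
    (fun s => [set s' : seq K | {subset s <= s'}]).
  have FF : Filter F.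
    apply: filter_from_filter; first by exists [::].
    move=> s1 s2 _ _; exists (s1 ++ s2) => // s ss.
    by split=> i is_; apply: ss; rewrite mem_cat is_ ?orbT.
  have [|s0 _ /(_ s0)] := (compact_near_coveringP _).1 K_compact _ F
      (fun s t => exists2 i, i \in s & V i t) FF; last first.
    by move=> s0V; exists s0 => t; exact: s0V.
  move=> t _; exists (V t, [set s : seq K | {subset [:: t] <= s}]) => /=.
    split; last by exists [:: t].
    by apply: open_nbhs_nbhs; split=> //; case: (cV t).
  by move=> [t' s] /= [Vt' ts]; exists t => //; apply: ts; rewrite inE.
(* Overlaps are resolved by taking the first member of the cover that contains
   t; it is locally constant in t since each V i is clopen. *)
pose rep t := nth t s (find (fun i => `[< V i t >]) s).
have hasV t : has (fun i => `[< V i t >]) s.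
  by apply/hasP; have [i is_ Vi] := sV t; exists i => //; exact/asboolP.
exists s, rep; split=> t.
- by rewrite mem_nth// -has_find.
- exact/asboolP/(nth_find t (hasV t)).
have : \forall t' \near t, forall i, i \in s -> `[< V i t' >] = `[< V i t >].
  elim: (s) => [|i s' IH]; first by near=> t'.
  have [oVi cVi] := cV i.
  have Vi : \forall t' \near t, `[< V i t' >] = `[< V i t >].
    have [Vit|nVit] := pselect (V i t).
      apply: filterS (open_nbhs_nbhs (conj oVi Vit)) => t' Vit'.
      by rewrite !asboolT.
    have nV : open_nbhs t (~` V i) by split=> //; exact: closed_openC.
    by apply: filterS (open_nbhs_nbhs nV) => t' nVit'; rewrite !asboolF.
  apply: filterS2 IH Vi => t' IH Vi j.
  by rewrite inE => /predU1P[->|/IH].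
apply: filterS => t' eqV; rewrite /rep (eq_in_find eqV).
by rewrite (set_nth_default t)// -has_find.
Unshelve. all: by end_near. Qed.

Lemma locally_constant_continuous (Y : topologicalType) (g : K -> Y) :
  (forall t, \forall t' \near t, g t' = g t) -> continuous g.
Proof.
move=> gE t A /nbhs_singleton Agt.
by apply: filterS (gE t) => t' /= ->.
Qed.

Lemma clopen_base_regular : has_clopen_base K -> regular_space K.
Proof.
move=> K_zd t A; rewrite nbhsE => -[B [oB Bt] BA].
have [V [[oV cV] Vt VB]] := K_zd t B oB Bt.
exists V; first by exists V.
by rewrite -((closure_id V).1 cV); exact: subset_trans BA.
Qed.

Lemma eval_continuous_compact (Y : topologicalType) :
  has_clopen_base K -> continuous (@eval K Y).
Proof.
move=> K_zd; apply: eval_continuous; last exact: clopen_base_regular.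
move=> t _; exists setT; first exact: filterT.
by split=> //; exact: closedT.
Qed.

End ClopenPartition.

(** * The compact-open topology as a uniform metric topology *)

Section Metric.
Context {R : realType} {T : topologicalType} (d : T -> T -> R).
Hypothesis dT : compatible_metric d.

Lemma metric_refl x : d x x = 0.
Proof. by case: dT => d0 _ _ _; exact/d0. Qed.

Lemma metric_sym x y : d x y = d y x.
Proof. by case: dT. Qed.

Lemma metric_triangle y x z : d x z <= d x y + d y z.
Proof. by case: dT. Qed.

Lemma metric_gt0 x y : x <> y -> 0 < d x y.
Proof.
move=> xy; have := metric_triangle y x x; rewrite metric_refl (metric_sym y x).
move=> d_ge0; have : 0 <= d x y by lra.
rewrite le_eqVlt => /predU1P[d0|//].
by case: xy; case: dT => d0E _ _ _; exact/d0E.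
Qed.

Lemma nbhs_metric_ball x (e : R) : 0 < e -> \forall y \near x, d x y < e.
Proof.
move=> e0; suff : nbhs x [set y | d x y < e] by [].
by case: dT => _ _ _ ->; exists e.
Qed.

End Metric.

Section UniformMetric.
Context {R : realType} {K X : topologicalType} (d : X -> X -> R).
Hypothesis K_compact : compact [set: K].
Hypothesis K_zero_dim : has_clopen_base K.
Hypothesis dX : compatible_metric d.

Definition uniform_ball (f : continuousType K X) (e : R) :
    set (continuousType K X) :=
  [set g | forall t, d (f t) (g t) < e].

Lemma continuous_joint_eval : continuous
  (fun z : continuousType K X * K => z.1 z.2).
Proof.
have -> : (fun z : continuousType K X * K => z.1 z.2) = eval.
  by apply/funext => -[].
exact: eval_continuous_compact.
Qed.

(** Both inclusions extend a pointwise estimate to a compact set by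
    near_covering: on a compact C inside f^-1(O), the distance from f t to the
    complement of O is bounded below; conversely, closeness of g to f at each
    point is uniform over K because evaluation is jointly continuous. *)
Lemma nbhs_uniform_ball (f : continuousType K X) :
  nbhs f = nbhs_ball_ uniform_ball f.
Proof.
have FF : Filter (nbhs_ball_ uniform_ball f).
  apply: filter_from_filter; first by exists 1 => /=.
  move=> e1 e2 /= e10 e20; exists (Num.min e1 e2).
    by rewrite /= lt_min e10.
  by move=> g fg; split=> t; have := fg t; rewrite lt_min => /andP[].
apply/seteqP; split=> A.
  move=> [_ [[W oW <-] Wf WA]].
  suff : (fun g : continuousType K X => g : {compact-open, K -> X}) @
      nbhs_ball_ uniform_ball f --> (f : {compact-open, K -> X}).
    move=> cvgf; apply: filterS WA _.
    exact: (cvgf W (open_nbhs_nbhs (conj oW Wf))).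
  apply/compact_open_cvgP => C O cC oO fCO; rewrite /nbhs /=.
  have near_C := (compact_near_coveringP _).1 cC _ (nbhs_ball_ uniform_ball f)
    (fun g t => O (g t)) FF.
  apply: filterS (near_C _) => [g gCO _ [t Ct <-]|t Ct].
    exact: gCO.
  have : nbhs (f t) O.
    by apply: open_nbhs_nbhs; split=> //; apply: fCO; exists t.
  case: (dX) => _ _ _ -> [e /= e0 eO].
  exists ([set t' | d (f t) (f t') < e / 2], uniform_ball f (e / 2)).
    split=> /=; last by exists (e / 2) => //=; rewrite divr_gt0.
    have e20 : 0 < e / 2 by rewrite divr_gt0.
    exact: (@cts_fun _ _ f t _ (nbhs_metric_ball dX (f t) e20)).
  move=> [t' g] /= [ft' fg]; apply: eO => /=.
  apply: le_lt_trans (metric_triangle dX (f t') _ _) _.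
  by have := fg t'; lra.
move=> [e /= e0 eA]; apply: filterS eA _.
have near_K := (compact_near_coveringP _).1 K_compact _ (nbhs f)
  (fun g t => d (f t) (g t) < e) (nbhs_filter f).
have e20 : 0 < e / 2 by rewrite divr_gt0.
apply: filterS (near_K _) => [g gK t|t _]; first exact: gK.
have ft : \forall t' \near t, d (f t) (f t') < e / 2.
  exact: (@cts_fun _ _ f t _ (nbhs_metric_ball dX (f t) e20)).
have fgt : \forall z \near (f, t),
    d (f t) ((z : continuousType K X * K).1 z.2) < e / 2.
  exact: (@continuous_joint_eval (f, t) _ (nbhs_metric_ball dX (f t) e20)).
case: fgt => [[P Q] /= [Pf Qt] PQ].
exists (Q `&` [set t' | d (f t) (f t') < e / 2], P).
  by split=> //; exact: filterI.
move=> [t' g] /= [[Qt' ft'] Pg].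
apply: le_lt_trans (metric_triangle dX (f t) _ _) _.
have /= := PQ (g, t') (conj Pg Qt').
by rewrite (metric_sym dX (f t')); lra.
Qed.

(** * Baire category in the space of continuous maps *)

(** The bounds e n need only have arbitrarily small values: as f m stays within
    e n of f n for all m >= n, one small e n gives both the pointwise Cauchy
    condition and the uniform estimate behind the continuity of the limit. *)
Lemma uniform_limit_exists (f : nat -> continuousType K X) (e : nat -> R) :
    complete_metric d -> (forall r, 0 < r -> exists n, e n < r) ->
    (forall m n t, (n <= m)%N -> d (f n t) (f m t) <= e n) ->
  exists g : continuousType K X, forall n t, d (f n t) (g t) <= e n.
Proof.
move=> dC e0 fe.
have /choice[g fg] : forall t, exists y : X, (fun n => f n t) @ \oo --> y.
  move=> t; apply: dC => r r0.
  have [|n en] := e0 (r / 2); first by rewrite divr_gt0.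
  exists n => p q np nq; apply: le_lt_trans (metric_triangle dX (f n t) _ _) _.
  rewrite (metric_sym dX (f p t)).
  by have := fe p n t np; have := fe q n t nq; lra.
have fge n t : d (f n t) (g t) <= e n.
  apply/ler_addgt0Pr => r r0.
  have [N _ NP] := fg t _ (nbhs_metric_ball dX (g t) r0).
  have := NP (maxn N n) (leq_maxl _ _); rewrite /= metric_sym// => gr.
  apply: le_trans (metric_triangle dX (f (maxn N n) t) _ _) _.
  by apply: lerD; [exact/fe/leq_maxr|exact: ltW].
have cg : continuous g.
  move=> t; case: (dX) => _ _ _ nE A; rewrite nE => -[r /= r0 rA].
  have r30 : 0 < r / 3 by rewrite divr_gt0.
  have [n en] := e0 _ r30.
  have fn : \forall s \near t, d (f n t) (f n s) < r / 3.
    exact: (@cts_fun _ _ (f n) t _ (nbhs_metric_ball dX (f n t) r30)).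
  suff : nbhs t (g @^-1` A) by [].
  apply: filterS fn => s fs; apply: rA => /=.
  apply: le_lt_trans (metric_triangle dX (f n t) _ _) _.
  rewrite (metric_sym dX (g t)).
  have := metric_triangle dX (f n s) (f n t) (g s).
  by have := fge n t; have := fge n s; lra.
by exists (mkcts cg).
Qed.

(** Baire's argument with closed uniform balls: each ball is chosen inside the
    previous one, off the next nowhere dense set and with radius at most
    1 / (n + 1), and the limit of the centres lies in all of them. *)
Lemma comeager_continuous_nonempty (A : set (continuousType K X)) (x0 : X) :
  complete_metric d -> comeager A -> A !=set0.
Proof.
move=> dC [F ndF AF].
pose cball (s : continuousType K X * R) :=
  [set g : continuousType K X | forall t, d (s.1 t) (g t) <= s.2].
have step (ns : nat * (continuousType K X * R)) :
    exists s : continuousType K X * R, 0 < ns.2.2 ->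
      [/\ 0 < s.2, s.2 <= ns.1.+1%:R^-1 & cball s `<=` cball ns.2 `\` F ns.1].
  case: ns => n [f e] /=.
  have [e0|ne0] := pselect (0 < e); last by exists (f, e).
  have [||g [fg nFg]] := (nowhere_denseE _).1 (ndF n) (uniform_ball f e)°.
  - by exists f; rewrite /interior /= nbhs_uniform_ball; exists e.
  - exact: open_interior.
  have : nbhs g (uniform_ball f e `&` ~` closure (F n)).
    apply: filterI; first exact: fg.
    apply: open_nbhs_nbhs; split=> //.
    by apply: closed_openC; exact: closed_closure.
  rewrite nbhs_uniform_ball => -[r /= r0 rP].
  exists (g, Num.min (r / 2) n.+1%:R^-1) => _ /=; split.
  - by rewrite lt_min divr_gt0//= invr_gt0.
  - by rewrite ge_min lexx orbT.
  - move=> h /= gh; have [|fh nFh] := rP h.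
      by move=> t; have := gh t; rewrite le_min => /andP[]; lra.
    by split=> [t|/subset_closure//]; exact/ltW/fh.
have [next nextP] := choice step.
pose fix s n : continuousType K X * R :=
  if n is m.+1 then next (m, s m)
  else (mkcts (@cst_continuous K X x0) : continuousType K X, 1).
have s0 n : 0 < (s n).2.
  elim: n => [|n IH]; first exact: ltr01.
  by have [] := nextP (n, s n) IH.
have sS n := nextP (n, s n) (s0 n).
have snest n m : (n <= m)%N -> cball (s m) `<=` cball (s n).
  move=> /subnK <-; elim: (m - n)%N => [//|k IH].
  by have [_ _ sub] := sS (k + n)%N; move=> h /sub[+ _]; exact: IH.
have sself n : cball (s n) (s n).1.
  by move=> t /=; rewrite (metric_refl dX) ltW.
have [||g gs] := uniform_limit_exists (f := fun n => (s n).1)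
    (e := fun n => (s n).2) dC.
- move=> r r0.
  have [n] := ltr_add_invr r0; rewrite add0r => nr.
  by have [_ sn _] := sS n; exists n.+1; exact: le_lt_trans nr.
- by move=> m n t nm; exact: (snest n m nm _ (sself m)).
exists g; apply: contrapT => nAg; have [n _ Fng] := AF g nAg.
by have [_ _ /(_ g (gs n.+1))[]] := sS n.
Qed.

End UniformMetric.

(** * Generic maps avoid a meager set of differences *)

Section GenericDifferences.
Context {R : realType} {K : topologicalType} {X : topologicalZmodType}.
Variables (dK : K -> K -> R) (dX : X -> X -> R).
Hypothesis K_compact : compact [set: K].
Hypothesis K_zero_dim : has_clopen_base K.
Hypothesis dKE : compatible_metric dK.
Hypothesis dXE : compatible_metric dX.

(** Bounding the distance of s and t away from 0 replaces the off-diagonal part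
    of K * K, which is not compact in general, by a compact set; this is what
    makes the condition open in f. *)
Definition separated_diff (r : R) (D : set X) : set (continuousType K X) :=
  [set f | forall s t, dK s t < r \/ D (f s - f t)].

Lemma open_separated_diff r D : open D -> open (separated_diff r D).
Proof.
move=> oD; rewrite openE => f fD.
have := (compact_near_coveringP _).1 (compact_setX K_compact K_compact) _
  (nbhs f) (fun g st => dK st.1 st.2 < r \/ D (g st.1 - g st.2))
  (nbhs_filter f).
rewrite setXTT => near_KK.
apply: filterS (near_KK _) => [g gD s t|[s t] _]; first exact: (gD (s, t)).
case: (fD s t) => [str|Dst].
  pose e := (r - dK s t) / 2.
  have e0 : 0 < e by rewrite divr_gt0// subr_gt0.
  (* Pairs close enough to (s, t) are still at distance less than r, whatever
     the map. *)
  exists ([set st | dK s st.1 < e /\ dK t st.2 < e], setT).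
    split=> /=; last exact: filterT.
    exists ([set s' | dK s s' < e], [set t' | dK t t' < e]) => //=.
    by split; exact: nbhs_metric_ball.
  move=> [[s' t'] g] /= [[ss' tt'] _]; left.
  have := metric_triangle dKE s s' t'; have := metric_triangle dKE t s t'.
  by rewrite (metric_sym dKE s' s) /e in ss' tt' *; lra.
have evc (p : K * K -> K) : continuous p ->
    continuous (fun z : K * K * continuousType K X => z.2 (p z.1)).
  move=> cp z; apply: (@continuous2_cvg _ _ _ _ _ _ snd (p \o fst)
    (fun (g : continuousType K X) k => g k)).
  - exact: (@continuous_joint_eval _ _ K_compact K_zero_dim (z.2, p z.1)).
  - exact: cvg_snd.
  - exact: (@continuous_comp _ _ _ fst p _ (@cvg_fst _ _ _ _ _) (cp _)).
have cdiff : continuous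
    (fun z : K * K * continuousType K X => z.2 z.1.1 - z.2 z.1.2).
  move=> z; apply: (@continuous2_cvg _ _ _ _ _ _
    (fun z : K * K * continuousType K X => z.2 z.1.1)
    (fun z : K * K * continuousType K X => z.2 z.1.2) (fun x y => x - y)).
  - exact: (@sub_continuous X (z.2 z.1.1, z.2 z.1.2)).
  - by apply: evc => st; exact: cvg_fst.
  - by apply: evc => st; exact: cvg_snd.
have := cdiff ((s, t), f) _ (open_nbhs_nbhs (conj oD Dst)).
by case=> -[P Q] PQ PQD; exists (P, Q) => // z /PQD; right.
Qed.

(** A locally constant map close to f is built on a partition into pieces of
    diameter less than r; a pair of points at distance at least r then takes two
    values that [perturb] has put in general position. *)
Lemma dense_separated_diff r D : 0 < r -> open D -> dense D ->
  dense (separated_diff r D).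
Proof.
move=> r0 oD dD O [f Of] oO.
have := open_nbhs_nbhs (conj oO Of).
rewrite (nbhs_uniform_ball K_compact K_zero_dim dXE) => -[e /= e0 eO].
have r20 : 0 < r / 2 by rewrite divr_gt0.
have e20 : 0 < e / 2 by rewrite divr_gt0.
have /choice[V VP] : forall t, exists V : set K, [/\ clopen V, V t &
    V `<=` [set s | dK t s < r / 2 /\ dX (f t) (f s) < e / 2]].
  move=> t.
  have : nbhs t [set s | dK t s < r / 2 /\ dX (f t) (f s) < e / 2].
    apply: filterI; first exact: nbhs_metric_ball.
    exact: (@cts_fun _ _ f t _ (nbhs_metric_ball dXE (f t) e20)).
  rewrite nbhsE => -[B [oB Bt] BP].
  by have [V [cV Vt VB]] := K_zero_dim oB Bt; exists V; split=> // s /VB /BP.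
have [S [rep [repS repV repE]]] := compact_clopen_representatives K_compact
  (fun t => let: And3 cV _ _ := VP t in cV)
  (fun t => let: And3 _ Vt _ := VP t in Vt).
have [j|j|x [Ux Dx]] := @perturb X _ S
  (fun j => [set y | dX (f j) y < e / 2]°) D oD dD.
- exact: open_interior.
- exists (f j); exact: nbhs_metric_ball.
have cg : continuous (x \o rep).
  apply: locally_constant_continuous => t.
  by apply: filterS (repE t) => s /= ->.
exists (mkcts cg); split.
  apply: eO => t /=; apply: le_lt_trans (metric_triangle dXE (f (rep t)) _ _) _.
  have [_ _ /(_ _ (repV t)) [_]] := VP (rep t); rewrite (metric_sym dXE (f t)).
  by have /interior_subset/= := Ux (rep t); lra.
move=> s t /=; have [st|st] := eqVneq (rep s) (rep t); last first.
  by right; exact: Dx.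
left; apply: le_lt_trans (metric_triangle dKE (rep s) _ _) _.
have [_ _ /(_ _ (repV s)) [+ _]] := VP (rep s).
have [_ _ /(_ _ (repV t)) [+ _]] := VP (rep t).
by rewrite -st (metric_sym dKE s); lra.
Qed.

(** Distinct points are at distance at least 1 / (m + 1) for some m, so the
    maps described here are cut out by countably many conditions
    [separated_diff]. *)
Lemma comeager_diff_notin (M : set X) : meager M ->
  comeager [set f : continuousType K X | forall s t, s <> t -> ~ M (f s - f t)].
Proof.
move=> [F ndF MF].
apply: (@comeager_bigcap _ (nat * nat)%type
  (fun i => separated_diff i.1.+1%:R^-1 (~` closure (F i.2)))) => [[m n]|f fG].
  have oF : open (~` closure (F n)).
    by apply: closed_openC; exact: closed_closure.
  split=> /=; first exact: open_separated_diff.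
  by apply: dense_separated_diff => //; apply/nowhere_denseE.
move=> s t st /MF[n _ Fn].
have [m] := ltr_add_invr (metric_gt0 dKE st); rewrite add0r => mst.
have [|/= ncl] := fG (m, n) I s t; first by rewrite /= ltNge ltW.
by apply: ncl; exact: subset_closure.
Qed.

End GenericDifferences.

(** * Haar-smallness from avoided differences *)

Lemma semi_ideal_subsingleton (K : Type) (I : set (set K)) (A : set K) :
    semi_ideal I -> \bigcup_(B in I) B = [set: K] ->
  (forall s t, A s -> A t -> s = t) -> I A.
Proof.
move=> [[B0 IB0] Isub] Icover A1.
have [[s As]|nA] := pselect (A !=set0); last first.
  by apply: Isub IB0 => s As; case: nA; exists s.
have [B IB Bs] : (\bigcup_(B in I) B) s by rewrite Icover.
by apply: Isub IB => t At; rewrite (A1 t s).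
Qed.

Lemma haar_witness_diff_notin (K : topologicalType) (X : topologicalZmodType)
    (I : set (set K)) (A : set X) (f : continuousType K X) :
    semi_ideal I -> \bigcup_(B in I) B = [set: K] ->
    (forall s t, s <> t -> ~ [set a - b | a in A & b in A] (f s - f t)) ->
  haar_witness I A f.
Proof.
move=> Isemi Icover fA x; apply: semi_ideal_subsingleton => // s t.
move=> [a Aa afs] [b Ab bft]; apply: contrapT => /fA; apply.
by exists a => //; exists b => //; rewrite -afs -bft opprD addrACA subrr addr0.
Qed.

Theorem corollary15p11 (R : realType)
    (K : topologicalType) (K_nonempty : [set: K] !=set0)
    (K_compact : compact [set: K]) (K_metrizable : metrizable R K)
    (K_zero_dim : has_clopen_base K)
    (I : set (set K)) (I_semi_ideal : semi_ideal I)
    (I_cover : \bigcup_(A in I) A = [set: K])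
    (X : topologicalZmodType) (X_polish : polish R X) :
  weak_steinhaus (GHI X I) /\ weak_steinhaus (HI X I).
Proof.
have [dK dKE] := K_metrizable; have [_ [dX dXE dXC]] := X_polish.
have generic (A : set X) : meager [set a - b | a in A & b in A] ->
    generically_haar I A.
  move=> mA.
  have [F ndF cF] := comeager_diff_notin K_compact K_zero_dim dKE dXE mA.
  exists F => // f nf; apply: cF => fA; apply: nf.
  exact: haar_witness_diff_notin.
split=> A bA nA mA; apply: nA; exists A; split=> //; first exact: generic.
by have [f fA] := comeager_continuous_nonempty K_compact K_zero_dim dXE 0 dXC
  (generic A mA); exists f.
Qed.
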